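(* Let $\Gamma$ be a tropical curve, and let $p \in \Gamma$ be a basepoint. If we endow the Jacobian $J(\Gamma)$ with the Foster/Zhang metric $\|\cdot\|_{\sup}$, then the image of a segment $e \subset \Gamma$ under the Abel-Jacobi map $\Phi_p: \Gamma \to J(\Gamma)$ has length $F(e)$. The image graph $\Phi_p(\Gamma)$ has total length $g(\Gamma)$, and each segment $\Phi_p(e)$ of the image graph has length at most $1$, with equality if and only if the segment $e$ forms a loop (i.e. $e^-=e^+$).
   Context: A weighted graph $G$ is a finite connected multigraph (loops and multiple edges allowed) with finite vertex set $V(G)\ne\emptyset$, finite edge set $E(G)$, lengths $\ell : E(G) \to \mathbb{R}_{>0}$, and an orientation: each edge $e$ has tail $e^-$ and head $e^+$. $C_1(G,A)$ is the free $A$-module on $E(G)$ ($A=\mathbb{Z}$ or $\mathbb{R}$), and $C_1(G,\mathbb{R})$ has the inner product $\langle\alpha_1,\alpha_2\rangle=\sum_e\alpha_1(e)\alpha_2(e)\ell(e)$. Let $(d^*\alpha)(x) = \sum_{e^+ = x}\alpha(e) - \sum_{e^-=x}\alpha(e)$ and $H_1(G,A) = \ker(d^* )\cap C_1(G,A)$. A 1-form $\omega = \sum_e \omega_e\, de$ (formal real combination) is harmonic if $\sum_{e^+=x}\omega_e = \sum_{e^-=x}\omega_e$ for all vertices $x$; $\Omega(G)$ is the space of harmonic 1-forms. Integration is bilinear with $\int_{e'} de = \ell(e)$ if $e=e'$, else $0$; each $\alpha\in C_1(G,\mathbb{R})$ gives $\int_\alpha\in\Omega(G)^*$, and $\alpha\mapsto\int_\alpha$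 is an isomorphism $H_1(G,\mathbb{R})\cong\Omega(G)^*$. If $G'$ is obtained from $G$ by length-preserving subdivision of edges with induced orientation (a refinement), with $e$ subdivided into $e_1,\dots,e_n$, then $r(e)=\sum e_i$ and $r_*(de)=\sum de_i$ induce isomorphisms $H_1(G,\mathbb{Z})\cong H_1(G',\mathbb{Z})$, $\Omega(G)\cong\Omega(G')$, compatible with integration. A tropical curve $\Gamma$ is a compact connected metric graph of finite total length, with a preferred model $G_0$ (a weighted graph whose geometric realization, gluing segments $[0,\ell(e)]$, is $\Gamma$); all other models are taken to have a common refinement with $G_0$. A segment of $\Gamma$ is the realization of an edge $e$ of $G_0$. $\Omega(\Gamma)\cong\Omega(G_0)$ is the direct limit of $\Omega(G)$ over models $G$, $H_1(\Gamma,\mathbb{Z})=H_1(G_0,\mathbb{Z})$ is embedded in $\Omega(\Gamma)^*$ by integration, and $J(\Gamma) = \Omega(\Gamma)^*/H_1(\Gamma,\mathbb{Z})$. The genus is $g(\Gamma)=\operatorname{rk}H_1(\Gamma,\mathbb{Z})=\#E(G_0)-\#V(G_0)+1$. Abel-Jacobi map: for $q\in\Gamma$ choose a model $G$ having $p$ and $q$ as vertices and a path $P$ in $G$ from $p$ to $q$, let $\alpha_P\in C_1(G,\mathbb{Z})$ be the signed count of traversals of each edge by $P$; $\Phi_p(q)$ is the class of $\int_{\alpha_P}\in\Omega(G)^*\cong\Omega(\Gamma)^*$ in $J(\Gamma)$. This is independent of choices and continuous. Foster/Zhang metric: for $\alpha=\sum_j a_je_j\in C_1(G,\mathbb{R})$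 put $\|\alpha\|_{\sup}=\max_j|a_j|$. Let $\pi:C_1(G,\mathbb{R})\to H_1(G,\mathbb{R})$ be orthogonal projection for $\langle\cdot,\cdot\rangle$, and put $\|\int_\alpha\|_{\sup}=\|\pi(\alpha)\|_{\sup}$; this is well defined on $\Omega(G)^*$ and independent of the model, hence defines $\|\cdot\|_{\sup}$ on $\Omega(\Gamma)^*$. The Foster coefficient of an edge $e$ is $F(e)=\|\pi(e)\|_{\sup}$. In the unit-speed coordinate $t\in[0,\ell(e)]$ on a segment $e$, the path $t\mapsto\Phi_p(e(t))$ lifts to an affine path in $\Omega(\Gamma)^*$ from some $v$ to some $v'$; the length of $\Phi_p(e)$ is $\|v'-v\|_{\sup}$. The segments of the image graph are the images of the segments of $\Gamma$, and its total length is the sum of their lengths. *)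

(* Defs.v *)
From HB Require Import structures.
From mathcomp Require Import all_boot all_order all_algebra.
From mathcomp Require Import boolp classical_sets reals.

Set Implicit Arguments.
Unset Strict Implicit.
Unset Printing Implicit Defensive.

Import Order.TTheory GRing.Theory Num.Theory.
Local Open Scope ring_scope.

(* A step of a walk: an edge traversed from tail to head (true) or from head
   to tail (false). *)
Definition step_source (V E : Type) (tl hd : E -> V) (s : E * bool) : V :=
  if s.2 then tl s.1 else hd s.1.
Definition step_target (V E : Type) (tl hd : E -> V) (s : E * bool) : V :=
  if s.2 then hd s.1 else tl s.1.

Fixpoint is_walk (V E : Type) (tl hd : E -> V)
    (x : V) (P : seq (E * bool)) (y : V) : Prop :=
  if P is s :: P' then
    step_source tl hd s = x /\ is_walk tl hd (step_target tl hd s) P' y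
  else x = y.

Record weighted_graph (R : realType) := WeightedGraph {
  vertex : finType;
  edge : finType;
  etail : edge -> vertex;
  ehead : edge -> vertex;
  elen : edge -> R;
  len_gt0 : forall e, 0 < elen e;
  vertex_nonempty : inhabited vertex;
  graph_connected : forall x y : vertex, exists P, is_walk etail ehead x P y }.

Arguments vertex {R} G : rename.
Arguments edge {R} G : rename.
Arguments etail {R} {G} e : rename.
Arguments ehead {R} {G} e : rename.
Arguments elen {R} {G} e : rename.

Notation walk G := (is_walk (@etail _ G) (@ehead _ G)).

Definition walk_chain (R : realType) (G : weighted_graph R)
    (P : seq (edge G * bool)) : {ffun edge G -> int} :=
  [ffun e => \sum_(s <- P | s.1 == e) (if s.2 then 1 else -1)].

(* Since the edge set is finite, [{ffun edge G -> A}] is both C_1(G, A) and,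
   for A = R, the space of 1-forms [\sum_e w e de]. *)

Section Homology.
Variables (R : realType) (G : weighted_graph R).

Definition dstar (A : zmodType) (a : {ffun edge G -> A}) :
    {ffun vertex G -> A} :=
  [ffun x => \sum_(e | ehead e == x) a e - \sum_(e | etail e == x) a e].

Definition is_cycle (A : zmodType) (a : {ffun edge G -> A}) : Prop :=
  dstar a = 0.

Definition real_chain (a : {ffun edge G -> int}) : {ffun edge G -> R^o} :=
  [ffun e => (a e)%:~R].

Definition edge_chain (e : edge G) : {ffun edge G -> R^o} :=
  [ffun f => (f == e)%:R].

Definition inner (a b : {ffun edge G -> R^o}) : R :=
  \sum_e a e * b e * elen e.

Definition integrate (a w : {ffun edge G -> R^o}) : R :=
  \sum_e a e * w e * elen e.

Definition harmonic (w : {ffun edge G -> R^o}) : Prop :=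
  forall x : vertex G, \sum_(e | ehead e == x) w e = \sum_(e | etail e == x) w e.

Fact dstar_linear : linear (@dstar R^o).
Proof.
move=> k a b; apply/ffunP => x; rewrite !ffunE.
under eq_bigr do rewrite !ffunE.
under [X in _ - X]eq_bigr do rewrite !ffunE.
by rewrite !big_split /= -!scaler_sumr scalerBr opprD addrACA.
Qed.

HB.instance Definition _ :=
  GRing.isLinear.Build R {ffun edge G -> R^o} {ffun vertex G -> R^o} _
    (@dstar R^o) dstar_linear.

Definition Omega : {vspace {ffun edge G -> R^o}} := lker (linfun (@dstar R^o)).

Lemma mem_Omega w : w \in Omega <-> harmonic w.
Proof.
rewrite memv_ker lfunE /=; split=> [/eqP/ffunP d0 x|h].
  by apply/eqP; rewrite -subr_eq0; have := d0 x; rewrite !ffunE => ->.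
by apply/eqP/ffunP => x; rewrite !ffunE h subrr.
Qed.

Definition Omega_dual := 'Hom(subvs_of Omega, R^o).

Fact integral_linear a : linear (integrate a : {ffun edge G -> R^o} -> R^o).
Proof.
move=> k w w'; rewrite /integrate scaler_sumr -big_split /=.
apply: eq_bigr => e _; rewrite !ffunE mulrDr mulrDl; congr (_ + _).
change (a e * (k * w e) * elen e = k * (a e * w e * elen e)).
by rewrite [a e * _]mulrCA -!mulrA.
Qed.

Definition int_chain (a : {ffun edge G -> R^o}) : Omega_dual :=
  linfun (fun w : subvs_of Omega => integrate a (vsval w) : R^o).

Lemma int_chainE a w : int_chain a w = integrate a (vsval w).
Proof.
pose lin := GRing.isLinear.Build R (subvs_of Omega) R^o _
  (fun w : subvs_of Omega => integrate a (vsval w) : R^o)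
  (fun k w w' => integral_linear a k (vsval w) (vsval w')).
pose f : {linear _ -> _} := HB.pack (fun w : subvs_of Omega =>
  integrate a (vsval w) : R^o) lin.
exact: (lfunE f).
Qed.

Definition is_H1_basis (n : nat) (b : 'I_n -> {ffun edge G -> int}) : Prop :=
  (forall i, is_cycle (b i)) /\
  (forall a : {ffun edge G -> int}, is_cycle a ->
     exists! c : {ffun 'I_n -> int}, a = \sum_i b i *~ c i).

(* H_1(G, Z) is free of finite rank and all its bases have the same size, so
   the default value 0 is only returned when the rank is 0. *)
Definition genus : nat :=
  xget 0%N [set n | exists b : 'I_n -> {ffun edge G -> int}, is_H1_basis b].

Definition sup_norm (a : {ffun edge G -> R^o}) : R :=
  \big[Num.max/0]_e `|a e|.

Definition H1_proj (a : {ffun edge G -> R^o}) : {ffun edge G -> R^o} :=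
  xget 0 [set b | is_cycle b /\ forall c, is_cycle c -> inner (a - b) c = 0].

(* [-1] is not the norm of anything: it could only be returned if the norm
   failed to be defined. *)
Definition dual_norm (phi : Omega_dual) : R :=
  xget (- 1) [set s | exists2 a, phi = int_chain a & s = sup_norm (H1_proj a)].

Definition foster (e : edge G) : R := sup_norm (H1_proj (edge_chain e)).

Definition jac_rel (phi psi : Omega_dual) : bool :=
  `[< exists2 a : {ffun edge G -> int},
        is_cycle a & phi - psi = int_chain (real_chain a) >].

Lemma int_chain0 : int_chain 0 = 0.
Proof.
apply/lfunP => w; rewrite int_chainE lfunE /= /integrate big1 // => e _.
by rewrite ffunE !mul0r.
Qed.

Lemma int_chainB a b : int_chain (a - b) = int_chain a - int_chain b.
Proof.
apply/lfunP => w; rewrite add_lfunE opp_lfunE !int_chainE /integrate.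
rewrite -sumrB; apply: eq_bigr => e _.
by rewrite !ffunE !mulrBl.
Qed.

Lemma real_chainB a b : real_chain (a - b) = real_chain a - real_chain b.
Proof. by apply/ffunP => e; rewrite !ffunE intrB. Qed.

Lemma is_cycleB (a b : {ffun edge G -> int}) :
  is_cycle a -> is_cycle b -> is_cycle (a - b).
Proof.
move=> a0 b0; suff -> : is_cycle (a - b) = (dstar a - dstar b = 0).
  by rewrite a0 b0 subrr.
congr (_ = _); apply/ffunP => x; rewrite !ffunE.
under eq_bigr do rewrite !ffunE.
under [X in _ - X]eq_bigr do rewrite !ffunE.
by rewrite !sumrB !opprD addrACA.
Qed.

Lemma is_cycle0 : is_cycle (0 : {ffun edge G -> int}).
Proof.
apply/ffunP => x; rewrite !ffunE !big1 ?subrr // => e _; by rewrite ffunE.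
Qed.

Fact jac_refl : reflexive jac_rel.
Proof.
move=> phi; apply/asboolP; exists 0; first exact: is_cycle0.
have -> : real_chain 0 = 0 by rewrite -(subrr 0) real_chainB subrr.
by rewrite int_chain0 subrr.
Qed.

Fact jac_triangle phi psi chi :
  jac_rel phi chi -> jac_rel psi chi -> jac_rel phi psi.
Proof.
move=> /asboolP[a a0 ea] /asboolP[b b0 eb]; apply/asboolP.
exists (a - b); first exact: is_cycleB.
by rewrite real_chainB int_chainB -ea -eb opprB subrKA.
Qed.

Fact jac_sym : symmetric jac_rel.
Proof.
by move=> phi psi; apply/idP/idP => h; apply: jac_triangle (jac_refl _) h.
Qed.

Fact jac_trans : transitive jac_rel.
Proof.
move=> psi phi chi h h'; apply: jac_triangle h _; by rewrite jac_sym.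
Qed.

Canonical jac_equiv := EquivRel jac_rel jac_refl jac_sym jac_trans.

Definition Jac := {eq_quot jac_equiv}%qT.

Definition jac_class (phi : Omega_dual) : Jac :=
  \pi_({eq_quot jac_equiv})%qT phi.

Lemma jac_classP phi psi : jac_class phi = jac_class psi <->
  exists2 a : {ffun edge G -> int},
    is_cycle a & phi - psi = int_chain (real_chain a).
Proof.
by split=> [/eqmodP/asboolP|h]; last apply/eqmodP/asboolP.
Qed.

End Homology.

(* A tropical curve is presented by its preferred model; the
   Abel-Jacobi map is computed in its refinements [subdivide c]. *)
Notation tropical_curve := weighted_graph.

Section Curve.
Variables (R : realType) (G : tropical_curve R).

(* A point of the geometric realization is a vertex, or an interior point
   [(e, t)] of an edge, at distance t from the tail of e. *)
Definition curve_point : Type :=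
  (vertex G + {z : edge G * R | 0 < z.2 < elen z.1})%type.

(* The point [e(t)] of the segment e, for 0 <= t <= elen e. *)
Definition seg_point (e : edge G) (t : R) : curve_point :=
  if insub (e, t) is Some z then inr z
  else inl (if t <= 0 then etail e else ehead e).

(* [cuts e] lists cut points of e in increasing order, all in ]0, elen e[. *)
Record subdivision := Subdivision {
  cuts : edge G -> seq R;
  cuts_sorted : forall e, path <%R 0 (rcons (cuts e) (elen e)) }.

Variable c : subdivision.

Definition sub_vertex : finType :=
  (vertex G + {e : edge G & 'I_(size (cuts c e))})%type.

(* [Tagged _ i] over e is the i-th of the edges into which e is divided. *)
Definition sub_edge : finType :=
  {e : edge G & 'I_(size (cuts c e)).+1}.

Definition breakpoint (e : edge G) (i : nat) : R :=
  nth 0 (0 :: rcons (cuts c e) (elen e)) i.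

Definition break_vertex (e : edge G) (i : nat) : sub_vertex :=
  if i is j.+1 then
    if (insub j : option 'I_(size (cuts c e))) is Some k then
      inr (Tagged (fun e => 'I_(size (cuts c e))) k)
    else inl (ehead e)
  else inl (etail e).

Definition sub_tail (f : sub_edge) : sub_vertex :=
  break_vertex (tag f) (tagged f).
Definition sub_head (f : sub_edge) : sub_vertex :=
  break_vertex (tag f) (tagged f).+1.
Definition sub_len (f : sub_edge) : R :=
  breakpoint (tag f) (tagged f).+1 - breakpoint (tag f) (tagged f).

Fact sub_len_gt0 f : 0 < sub_len f.
Proof.
case: f => e i; rewrite /sub_len /breakpoint /= subr_gt0.
have /(pathP 0) := cuts_sorted c e; apply.
by rewrite size_rcons.
Qed.

Fact sub_nonempty : inhabited sub_vertex.
Proof. by case: (vertex_nonempty G) => v; exists; left. Qed.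

Let joined (x y : sub_vertex) := exists P, is_walk sub_tail sub_head x P y.

Let joined_trans x y z : joined x y -> joined y z -> joined x z.
Proof.
move=> [P wP] [Q wQ]; exists (P ++ Q).
by elim: P x wP => [x /= ->|s P IH x /= [-> /IH]] //.
Qed.

Let joined_step f b : joined (step_source sub_tail sub_head (f, b))
                             (step_target sub_tail sub_head (f, b)).
Proof. by exists [:: (f, b)]. Qed.

Let joined_sym x y : joined x y -> joined y x.
Proof.
move=> [P]; elim: P x => [x /= ->|[f b] P IH x /= [<- /IH h]].
  by exists [::].
apply: joined_trans h _; have := joined_step f (~~ b).
by rewrite /step_source /step_target /=; case: b.
Qed.

Let joined_edge e i :
  (i <= (size (cuts c e)).+1)%N -> joined (inl (etail e)) (break_vertex e i).
Proof.
elim: i => [|i IH] ltin; first by exists [::].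
apply: joined_trans (IH (ltnW ltin)) _.
exact: (joined_step
  (Tagged (fun e => 'I_(size (cuts c e)).+1) (Ordinal ltin)) true).
Qed.

Let joined_head e : joined (inl (etail e)) (inl (ehead e)).
Proof.
have := @joined_edge e (size (cuts c e)).+1 (leqnn _).
by rewrite /break_vertex insubF ?ltnn.
Qed.

Let joined_old (x : vertex G) y : joined (inl x) (inl y).
Proof.
have [P] := graph_connected x y; elim: P x => [x /= ->|[e b] P IH x].
  by exists [::].
move=> /= [<- /IH]; apply: joined_trans; rewrite /step_source /step_target /=.
by case: b; [|apply: joined_sym]; apply: joined_head.
Qed.

Let joined_new x : exists v : vertex G, joined (inl v) x.
Proof.
case: x => [v|[e k]]; first by exists v; exists [::].
exists (etail e); have := @joined_edge e k.+1 (ltnW (ltn_ord k)).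
by rewrite /break_vertex valK.
Qed.

Fact sub_connected x y : joined x y.
Proof.
have [[v vx] [w wy]] := (joined_new x, joined_new y).
exact: joined_trans (joined_sym vx) (joined_trans (joined_old v w) wy).
Qed.

Definition subdivide : weighted_graph R :=
  WeightedGraph sub_len_gt0 sub_nonempty sub_connected.

Definition vertex_point (x : vertex subdivide) : curve_point :=
  match x with
  | inl v => inl v
  | inr k => seg_point (tag k) (breakpoint (tag k) (tagged k).+1)
  end.

(* The isomorphism from [Omega G] to [Omega subdivide]. *)
Definition refine_form (w : {ffun edge G -> R^o}) :
    {ffun edge subdivide -> R^o} :=
  [ffun f : sub_edge => w (tag f)].

(* Integration along a chain of a model, transported to [Omega G] along
   [refine_form]. *)
Definition int_model (a : {ffun edge subdivide -> R^o}) : Omega_dual G :=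
  linfun (fun w : subvs_of (Omega G) =>
    integrate a (refine_form (vsval w)) : R^o).

Lemma int_modelE a w : int_model a w = integrate a (refine_form (vsval w)).
Proof.
have linf : linear (fun w : subvs_of (Omega G) =>
    integrate a (refine_form (vsval w)) : R^o).
  move=> k u u'; rewrite -integral_linear; congr integrate.
  by apply/ffunP => f; rewrite !ffunE.
pose lin := GRing.isLinear.Build R (subvs_of (Omega G)) R^o _ _ linf.
pose f : {linear _ -> _} := HB.pack (fun w : subvs_of (Omega G) =>
  integrate a (refine_form (vsval w)) : R^o) lin.
exact: (lfunE f).
Qed.

End Curve.

Section AbelJacobi.
Variables (R : realType) (G : tropical_curve R) (p : curve_point G).

(* The value does not depend on the model and the walk, and both exist, so the
   default value is never used. *)
Definition abel_jacobi (q : curve_point G) : Jac G :=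
  xget (jac_class 0) [set xi | exists (c : subdivision G)
    (x y : vertex (subdivide c)) (P : seq (edge (subdivide c) * bool)),
    [/\ vertex_point x = p, vertex_point y = q, walk (subdivide c) x P y
      & xi = jac_class (int_model (real_chain (walk_chain P)))]].

Definition affine_lift (e : edge G) (v v' : Omega_dual G) : Prop :=
  forall t : R, 0 <= t <= elen e ->
    abel_jacobi (seg_point e t) = jac_class (v + (t / elen e) *: (v' - v)).

(* As for [dual_norm], the default value [-1] is not a length. *)
Definition image_length (e : edge G) : R :=
  xget (- 1) [set L | exists v v',
    affine_lift e v v' /\ L = dual_norm (v' - v)].

Definition image_total_length : R := \sum_e image_length e.

End AbelJacobi.

(* Main.v *)
Require Import Defs.
From mathcomp Require Import all_boot all_order all_algebra.
From mathcomp Require Import boolp classical_sets reals.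
From HB Require Import structures.
From mathcomp Require Import finset ring lra.

(** Everything about the image length reduces to linear algebra on the chains
    of the given model.

    A point [q] gets a real chain [point_chain q]: a fixed path from a root to
    the tail of the segment containing [q], plus the fraction of that segment
    that lies before [q].  An edge of a subdivision moves this chain by the
    corresponding fraction of a segment, up to an integral cycle (the cycle
    appears only on arriving at the head of the segment, whose own fixed path
    may be different).  By induction along a walk, the Abel-Jacobi image of [q]
    is the class of [point_chain q - point_chain p] in whatever model it is
    computed ([abel_jacobiE]).  So the segment [e] lifts to an affine path with
    displacement [int_chain (edge_chain e)].  Two affine lifts of one path
    differ by an affine path inside the lattice, and the lattice contains no
    real line ([lattice_no_line]); hence the displacement is determined by [e],
    and its norm is the Foster coefficient by definition.

    Let pi be the orthogonal projection on cycles.  The Foster coefficient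
    F(e) = max_f |pi(e)(f)| is the diagonal entry pi(e)(e).  Indeed e - pi(e)
    is orthogonal to cycles, hence it is the gradient of a potential, and off
    [e] the cycle pi(e) is a current that flows down this potential.  The level
    set of the potential that separates the endpoints of [f] is then crossed in
    the same direction by the current of every edge other than [e], so [e] must
    carry back at least as much as [f] carries ([H1_proj_diag_max]).

    The rest is about diagonal entries of an orthogonal projection.  Their sum
    is a trace, which a spanning tree makes explicit: every cycle is the
    combination of the fundamental cycles with the cotree coordinates as
    coefficients ([cycle_expand]), over Z and over R alike, so both the genus
    and the trace count the cotree edges ([genus_cotree], [sum_foster]).
    Pythagoras gives (1 - pi(e)(e)) l(e) = |e - pi(e)|^2 >= 0, with equality if
    and only if [e] is itself a cycle, that is a loop. *)

Set Implicit Arguments.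
Unset Strict Implicit.
Unset Printing Implicit Defensive.

Import Order.TTheory GRing.Theory Num.Theory.
Local Open Scope ring_scope.

(** * Chains, boundaries and spanning trees *)

Lemma ffun_mulrz (I : finType) (A : zmodType) (a : {ffun I -> A}) (n : int) i :
  (a *~ n) i = a i *~ n.
Proof. by case: n => n; rewrite ?NegzE ?mulrNz ?ffunE -!pmulrn ffunMnE. Qed.

Section Chains.
Variables (R : realType) (G : weighted_graph R).

Definition delta (e : edge G) : {ffun edge G -> int} := [ffun f => (f == e)%:R].

Lemma real_chain_delta e : real_chain (delta e) = edge_chain e.
Proof. by apply/ffunP => f; rewrite !ffunE; case: eqP. Qed.

Lemma dstarB (A : zmodType) (a b : {ffun edge G -> A}) :
  dstar (a - b) = dstar a - dstar b.
Proof.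
apply/ffunP => x; rewrite !ffunE.
under eq_bigr do rewrite !ffunE.
under [X in _ - X]eq_bigr do rewrite !ffunE.
by rewrite !sumrB !opprD addrACA.
Qed.

Lemma dstarD (A : zmodType) (a b : {ffun edge G -> A}) :
  dstar (a + b) = dstar a + dstar b.
Proof. by have := dstarB (a + b) b; rewrite addrK => ->; rewrite subrK. Qed.

Lemma dstar_real_chain (a : {ffun edge G -> int}) :
  dstar (real_chain a) = [ffun v => (dstar a v)%:~R].
Proof.
apply/ffunP => v; rewrite !ffunE rmorphB !rmorph_sum.
by congr (_ - _); apply: eq_bigr => e _; rewrite ffunE.
Qed.

Lemma is_cycle_real_chain (a : {ffun edge G -> int}) :
  is_cycle a -> is_cycle (real_chain a).
Proof.
by move=> a0; apply/ffunP => v; rewrite dstar_real_chain a0 !ffunE.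
Qed.

Lemma sum_delta (A : nzRingType) (P : pred (edge G)) e :
  \sum_(f | P f) ((f == e)%:R : A) = (P e)%:R.
Proof.
case Pe: (P e).
  rewrite (bigD1 e) //= eqxx big1 ?addr0 // => f /andP[_ /negPf->] //.
rewrite big1 // => f Pf; case: eqP => // fe; by rewrite -fe Pf in Pe.
Qed.

Lemma dstar_delta e :
  dstar (delta e) = [ffun v => (ehead e == v)%:R - (etail e == v)%:R].
Proof.
apply/ffunP => v; rewrite !ffunE.
under eq_bigr do rewrite ffunE.
under [X in _ - X]eq_bigr do rewrite ffunE.
by rewrite !sum_delta.
Qed.

(** Summation by parts: the boundary is adjoint to the difference operator on
    potentials.  Potentials are integral so that the coefficients of the chain
    may lie in any abelian group, in particular in Z and in R. *)
Lemma dstar_by_parts (A : zmodType) (a : {ffun edge G -> A})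
    (g : vertex G -> int) :
  \sum_e a e *~ (g (ehead e) - g (etail e)) = \sum_v dstar a v *~ g v.
Proof.
under eq_bigr do rewrite mulrzBr.
under [RHS]eq_bigr do rewrite ffunE mulrzBl.
rewrite !sumrB; congr (_ - _).
  rewrite (partition_big (@ehead R G) xpredT) //=; apply: eq_bigr => v _.
  by rewrite mulrz_suml; apply: eq_bigr => e /eqP->.
rewrite (partition_big (@etail R G) xpredT) //=; apply: eq_bigr => v _.
by rewrite mulrz_suml; apply: eq_bigr => e /eqP->.
Qed.

Lemma walk_crosses (S : {set vertex G}) x P y : walk G x P y ->
  x \in S -> y \notin S -> exists s : edge G * bool,
    step_source etail ehead s \in S /\ step_target etail ehead s \notin S.
Proof.
elim: P x => [x /= -> -> //|s P IH x /= [<- w] xS yS].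
by case tS: (step_target etail ehead s \in S);
  [exact: IH w tS yS|exists s; rewrite tS].
Qed.

(** A spanning tree is recorded through what the proof needs of it: for each
    vertex a chain supported on the tree and going from the root to the vertex.
    The last field says that along a tree edge this chain is extended by that
    edge; it replaces acyclicity. *)
Record spanning_tree := SpanningTree {
  tree_edges : {set edge G};
  root : vertex G;
  tree_path : vertex G -> {ffun edge G -> int};
  tree_path_supp : forall v e, e \notin tree_edges -> tree_path v e = 0;
  dstar_tree_path : forall v,
    dstar (tree_path v) = [ffun x => (v == x)%:R - (root == x)%:R];
  tree_path_edge : forall e, e \in tree_edges ->
    tree_path (ehead e) - tree_path (etail e) = delta e }.

(** Grow the tree from the root: as long as some vertex is not reached, a walk
    from the root to it leaves the set of reached vertices, and the edge by
    which it leaves is added to the tree. *)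
Lemma spanning_tree_exists : inhabited spanning_tree.
Proof.
have [r] := vertex_nonempty G.
suff grow n (S : {set vertex G}) (T : {set edge G})
    (t : vertex G -> {ffun edge G -> int}) : #|~: S| = n -> r \in S ->
    (forall e, e \in T -> etail e \in S /\ ehead e \in S) ->
    (forall v e, e \notin T -> t v e = 0) ->
    (forall v, v \in S ->
       dstar (t v) = [ffun x => (v == x)%:R - (r == x)%:R]) ->
    (forall e, e \in T -> t (ehead e) - t (etail e) = delta e) ->
    inhabited spanning_tree.
  apply: (grow _ [set r] set0 (fun=> 0) erefl) => [|e|v e _|v|e].
  - by rewrite set11.
  - by rewrite in_set0.
  - by rewrite ffunE.
  - move=> /set1P->.
    have -> : (0 : {ffun edge G -> int}) = 0 - 0 by rewrite subrr.
    by rewrite dstarB subrr; apply/ffunP => x; rewrite !ffunE subrr.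
  - by rewrite in_set0.
elim: n S T t => [|n IH] S T t cS rS TS t0 td te.
  have ST v : v \in S.
    move/eqP: cS; rewrite cards_eq0 => /eqP/setP/(_ v).
    by rewrite !inE => /negbFE.
  by split; apply: (SpanningTree t0 _ te) => v; apply: td.
have [w] : exists w, w \in ~: S by apply/set0Pn; rewrite -card_gt0 cS.
rewrite inE => wS; have [P wP] := graph_connected r w.
have [[e b] []] := walk_crosses wP rS wS.
set u := step_source _ _ _; set z := step_target _ _ _ => uS zS.
have eT : e \notin T.
  by apply: contraNN zS => /TS[]; rewrite /z /step_target; case: (b).
pose tz : {ffun edge G -> int} := if b then t u + delta e else t u - delta e.
apply: (IH (z |: S) (e |: T) (fun v => if v == z then tz else t v)).
- have -> : ~: (z |: S) = ~: S :\ z by rewrite setCU setDE setIC.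
  by move: cS; rewrite (cardsD1 z) inE zS => -[].
- by rewrite inE rS orbT.
- move=> f; rewrite !inE => /predU1P[->|/TS[-> ->]]; last by rewrite !orbT.
  by move: uS; rewrite /u /z /step_source /step_target; case: (b) => /= ->;
    rewrite eqxx !orbT.
- move=> v f; rewrite !inE negb_or => /andP[/negPf fe fT].
  by case: eqP => _; rewrite ?t0 // /tz; case: (b); rewrite !ffunE fe t0.
- move=> v; rewrite !inE; case: eqP => [-> _|_ /= vS]; last exact: td.
  rewrite /tz; case: (b) @u @z uS {zS tz} => /= uS;
    rewrite ?(dstarB, dstarD) td // dstar_delta;
    apply/ffunP => x; rewrite !ffunE /step_source /step_target /=; ring.
- have nz v : v \in S -> (v == z) = false.
    by move=> vS; apply: contraNF zS => /eqP<-.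
  move=> f; rewrite !inE => /predU1P[->|fT].
    move: (nz u uS); rewrite /tz /u /z /step_source /step_target /=.
    case: (b) => /= ->; rewrite eqxx; first by rewrite addrC addKr.
    by rewrite opprB addrC subrK.
  by have [tS hS] := TS _ fT; rewrite !nz // te.
Qed.

End Chains.

(** * Fundamental cycles and the genus *)

Section FundamentalCycles.
Variables (R : realType) (G : weighted_graph R) (T : spanning_tree G).

Local Notation tau := (tree_path T).

Definition fund_cycle (e : edge G) : {ffun edge G -> int} :=
  delta e - (tau (ehead e) - tau (etail e)).

Lemma is_cycle_fund e : is_cycle (fund_cycle e).
Proof.
rewrite /is_cycle /fund_cycle !dstarB dstar_delta !dstar_tree_path.
apply/ffunP => v; rewrite !ffunE; ring.
Qed.

Lemma fund_cycle_tree e : e \in tree_edges T -> fund_cycle e = 0.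
Proof. by move=> eT; rewrite /fund_cycle tree_path_edge // subrr. Qed.

Lemma fund_cycle_cotree e f :
  f \notin tree_edges T -> fund_cycle e f = (f == e)%:R.
Proof. by move=> fT; rewrite !ffunE !tree_path_supp // subrr subr0. Qed.

(** Write every edge as its fundamental cycle plus the difference of two tree
    paths.  In the expansion of a cycle, the tree paths are weighted by the
    boundary of the cycle, so they drop out; and the fundamental cycle of a tree
    edge is 0. *)
Lemma cycle_expand (A : zmodType) (a : {ffun edge G -> A}) f : is_cycle a ->
  a f = \sum_(e | e \notin tree_edges T) a e *~ fund_cycle e f.
Proof.
move=> a0; symmetry.
rewrite big_mkcond (eq_bigr (fun e => a e *~ fund_cycle e f)); last first.
  move=> e _; case: ifP => // /negbFE eT.
  by rewrite fund_cycle_tree // ffunE mulr0z.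
have -> : \sum_e a e *~ fund_cycle e f =
    \sum_e a e *~ (delta e f) -
    \sum_e a e *~ (tau (ehead e) f - tau (etail e) f).
  rewrite -sumrB; apply: eq_bigr => e _; by rewrite !ffunE [LHS]mulrzBr.
rewrite (dstar_by_parts a (fun v => tau v f)) a0.
rewrite [X in _ - X]big1 ?subr0; last first.
  by move=> v _; rewrite ffunE mul0rz.
rewrite (bigD1 f) //= ffunE eqxx mulr1z big1 ?addr0 // => e ef.
by rewrite ffunE eq_sym (negPf ef) mulr0z.
Qed.

Lemma fund_cycle_basis :
  @is_H1_basis R G #|~: tree_edges T| (fun i => fund_cycle (enum_val i)).
Proof.
split=> [i|a a0]; first exact: is_cycle_fund.
exists [ffun i => a (enum_val i)]; split.
  apply/ffunP => f; rewrite sum_ffunE (cycle_expand f a0).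
  under eq_bigl do rewrite -in_setC.
  rewrite big_enum_val /=; apply: eq_bigr => i _.
  by rewrite ffun_mulrz [X in _ = _ *~ X]ffunE !mulrzz mulrC.
move=> c ->; apply/ffunP => i; rewrite ffunE sum_ffunE (bigD1 i) //=.
have iT : enum_val i \notin tree_edges T by have := enum_valP i; rewrite inE.
rewrite ffun_mulrz fund_cycle_cotree // eqxx intz big1 ?addr0 // => j ji.
rewrite ffun_mulrz fund_cycle_cotree // (inj_eq enum_val_inj).
by rewrite eq_sym (negPf ji) mul0rz.
Qed.

End FundamentalCycles.

Section Genus.
Variables (R : realType) (G : weighted_graph R).

(** The two changes of basis are mutually inverse integer matrices, and a
    product of rectangular matrices can be the identity only if the inner
    dimension is at least the outer one. *)
Lemma H1_basis_leq n m (b : 'I_n -> {ffun edge G -> int})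
    (b' : 'I_m -> {ffun edge G -> int}) :
  is_H1_basis b -> is_H1_basis b' -> (n <= m)%N.
Proof.
move=> [b0 bE] [b'0 b'E].
have /choice[d dE] : forall i,
    exists d : {ffun 'I_m -> int}, b i = \sum_j b' j *~ d j.
  by move=> i; have [d [? _]] := b'E _ (b0 i); exists d.
have /choice[c cE] : forall j,
    exists c : {ffun 'I_n -> int}, b' j = \sum_k b k *~ c k.
  by move=> j; have [d' [? _]] := bE _ (b'0 j); exists d'.
pose D : 'M[int]_(n, m) := \matrix_(i, j) d i j.
pose C : 'M[int]_(m, n) := \matrix_(j, k) c j k.
suff /mulmx1_min : D *m C = 1%:M by [].
apply/matrixP => i k.
have [x [_ ux]] := bE _ (b0 i).
have e1 : x = [ffun k => (i == k)%:R].
  apply: ux; rewrite (bigD1 i) //= ffunE eqxx mulr1z big1 ?addr0 // => j ji.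
  by rewrite ffunE eq_sym (negPf ji) mulr0z.
have e2 : x = [ffun k => (D *m C) i k].
  apply: ux; rewrite {1}dE.
  under eq_bigr do rewrite cE mulrz_suml.
  rewrite exchange_big; apply: eq_bigr => l _ /=.
  rewrite ffunE mxE mulrz_sumr; apply: eq_bigr => j _.
  by rewrite !mxE -mulrzA mulrC.
by move: e2; rewrite e1 => /ffunP/(_ k); rewrite !ffunE => <-; rewrite mxE.
Qed.

Lemma genus_cotree (T : spanning_tree G) : genus G = #|~: tree_edges T|.
Proof.
apply: xget_unique => [|n [b bB]].
  by exists (fun i => fund_cycle T (enum_val i)); exact: fund_cycle_basis.
apply/eqP; rewrite eqn_leq (H1_basis_leq bB (fund_cycle_basis T)).
by rewrite (H1_basis_leq (fund_cycle_basis T) bB).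
Qed.

End Genus.

(** * The orthogonal projection on cycles *)

Section Projection.
Variables (R : realType) (G : weighted_graph R).
Implicit Types (a b c : {ffun edge G -> R^o}) (e : edge G).

Lemma innerC a b : inner a b = inner b a.
Proof. by apply: eq_bigr => e _; rewrite [a e * b e]mulrC. Qed.

Lemma innerBl a b c : inner (a - b) c = inner a c - inner b c.
Proof. by rewrite -sumrB; apply: eq_bigr => e _; rewrite !ffunE !mulrBl. Qed.

Lemma inner_edge a e : inner a (edge_chain e) = a e * elen e.
Proof.
rewrite /inner (bigD1 e) //= ffunE eqxx mulr1 big1 ?addr0 // => f /negPf fe.
by rewrite ffunE fe mulr0 mul0r.
Qed.

Lemma inner_ge0 a : 0 <= inner a a.
Proof.
by apply: sumr_ge0 => e _; rewrite mulr_ge0 ?sqr_ge0 // ltW // len_gt0.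
Qed.

Lemma inner_eq0 a : inner a a = 0 -> a = 0.
Proof.
move=> /eqP; rewrite psumr_eq0 => [/allP a0|e _]; last first.
  by rewrite mulr_ge0 ?sqr_ge0 // ltW // len_gt0.
apply/ffunP => e; rewrite ffunE; apply/eqP.
have := a0 e (mem_index_enum _).
by rewrite mulf_eq0 (gt_eqF (len_gt0 e)) orbF mulf_eq0 orbb.
Qed.

(** Harmonic forms and real cycles satisfy the same equations, so the inner
    product pairs cycles with themselves and integration becomes a perfect
    pairing. *)
Lemma mem_OmegaE a : (a \in Omega G) <-> is_cycle a.
Proof.
by rewrite memv_ker lfunE; split=> [/eqP|a0]; last apply/eqP.
Qed.

Lemma int_chain_eqP a b :
  int_chain a = int_chain b <-> forall c, is_cycle c -> inner (a - b) c = 0.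
Proof.
split=> [/lfunP ab c /mem_OmegaE cO|ab].
  have := ab (Subvs cO); rewrite !int_chainE /= => abc.
  by rewrite innerBl /inner -/(integrate a c) abc subrr.
apply/lfunP => w; rewrite !int_chainE; apply/eqP; rewrite -subr_eq0.
rewrite -[_ - _]/(inner a (vsval w) - inner b (vsval w)) -innerBl ab //.
exact/mem_OmegaE/subvsP.
Qed.

Lemma integrate_linearl k a b w :
  integrate (k *: a + b) w = k * integrate a w + integrate b w.
Proof.
rewrite /integrate mulr_sumr -big_split; apply: eq_bigr => e _ /=.
by rewrite !ffunE !mulrDl !mulrA.
Qed.

Lemma int_chain_is_linear : linear (@int_chain R G).
Proof.
move=> k a b; apply/lfunP => w; rewrite add_lfunE scale_lfunE !int_chainE.
exact: integrate_linearl.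
Qed.

HB.instance Definition _ := GRing.isLinear.Build R {ffun edge G -> R^o}
  (Omega_dual G) _ (@int_chain R G) int_chain_is_linear.

Lemma int_chainZ k a : int_chain (k *: a) = k *: int_chain a.
Proof. by have := int_chain_is_linear k a 0; rewrite int_chain0 !addr0. Qed.

Lemma is_cycle_sub a b : is_cycle a -> is_cycle b -> is_cycle (a - b).
Proof. by rewrite /is_cycle dstarB => -> ->; rewrite subrr. Qed.

Lemma int_chain_inj_cycle a b :
  is_cycle a -> is_cycle b -> int_chain a = int_chain b -> a = b.
Proof.
move=> a0 b0 /int_chain_eqP/(_ _ (is_cycle_sub a0 b0))/inner_eq0/eqP.
by rewrite subr_eq0 => /eqP.
Qed.

(** Injectivity on cycles and equality of dimensions: the inner product makes
    the space of cycles its own dual. *)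
Lemma int_chain_surj (phi : Omega_dual G) :
  exists2 a, is_cycle a & int_chain a = phi.
Proof.
pose h : 'Hom(subvs_of (Omega G), Omega_dual G) :=
  linfun (@int_chain R G \o vsval).
have hE u : h u = int_chain (vsval u) by rewrite lfunE.
have h0 : lker h == 0%VS.
  apply/lker0P => u v; rewrite !hE => /int_chain_inj_cycle uv.
  by apply: val_inj; apply: uv; apply/mem_OmegaE/subvsP.
have : phi \in limg h.
  suff -> : limg h = fullv by apply: memvf.
  apply/eqP; rewrite eqEdim subvf /= limg_dim_eq; last first.
    by rewrite (eqP h0) capv0.
  by rewrite !dimvf /dim /= muln1.
case/memv_imgP => u _ ->; exists (vsval u); last by rewrite hE.
exact/mem_OmegaE/subvsP.
Qed.

(** The projection of [a] exists because the functional of integration along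
    [a] is also represented by a cycle. *)
Lemma H1_projP a :
  is_cycle (H1_proj a) /\ forall c, is_cycle c -> inner (a - H1_proj a) c = 0.
Proof.
have [b b0 ba] := int_chain_surj (int_chain a).
suff /(xgetPex 0) : exists b, is_cycle b /\
    forall c, is_cycle c -> inner (a - b) c = 0 by [].
by exists b; split=> //; apply/int_chain_eqP.
Qed.

Lemma is_cycle_H1_proj a : is_cycle (H1_proj a).
Proof. exact: (proj1 (H1_projP a)). Qed.

Lemma int_chain_H1_proj a : int_chain (H1_proj a) = int_chain a.
Proof. by apply/esym/int_chain_eqP; case: (H1_projP a). Qed.

Lemma H1_proj_eq a b : int_chain a = int_chain b -> H1_proj a = H1_proj b.
Proof.
move=> ab; apply: int_chain_inj_cycle; [exact: is_cycle_H1_proj..|].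
by rewrite !int_chain_H1_proj.
Qed.

Lemma dual_norm_int_chain a : dual_norm (int_chain a) = sup_norm (H1_proj a).
Proof.
apply: xget_unique; first by exists a.
by move=> s [b /H1_proj_eq ab ->]; rewrite ab.
Qed.

Lemma inner_H1_proj a b : inner (H1_proj a) b = inner (H1_proj a) (H1_proj b).
Proof.
apply/eqP; rewrite -subr_eq0 ![inner (H1_proj a) _]innerC -innerBl.
by rewrite (proj2 (H1_projP b)) //; exact: is_cycle_H1_proj.
Qed.

(** Self-adjointness of the projection, in the orthogonal basis of edges. *)
Lemma H1_proj_edge_sym e f :
  H1_proj (edge_chain e) f * elen f = H1_proj (edge_chain f) e * elen e.
Proof.
by rewrite -!inner_edge inner_H1_proj innerC -inner_H1_proj.
Qed.

Lemma H1_proj_diag_ge0 e : 0 <= H1_proj (edge_chain e) e.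
Proof.
have := inner_ge0 (H1_proj (edge_chain e)).
by rewrite -inner_H1_proj inner_edge pmulr_lge0 // len_gt0.
Qed.

(** Pythagoras: the distance from [e] to the space of cycles is measured by the
    defect of the diagonal entry from 1. *)
Lemma inner_H1_projK e :
  (1 - H1_proj (edge_chain e) e) * elen e =
  inner (edge_chain e - H1_proj (edge_chain e))
        (edge_chain e - H1_proj (edge_chain e)).
Proof.
set u := edge_chain e; set v := H1_proj u.
rewrite [in RHS]innerBl [inner u _]innerC [inner v _]innerC.
rewrite [X in _ = _ - X](proj2 (H1_projP u)); last exact: is_cycle_H1_proj.
by rewrite subr0 inner_edge !ffunE eqxx.
Qed.

Lemma H1_proj_diag_le1 e : H1_proj (edge_chain e) e <= 1.
Proof.
by rewrite -subr_ge0 -(pmulr_lge0 _ (len_gt0 e)) inner_H1_projK inner_ge0.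
Qed.

Lemma is_cycle_edge e : is_cycle (edge_chain e) <-> etail e = ehead e.
Proof.
rewrite /is_cycle -real_chain_delta dstar_real_chain dstar_delta.
split=> [/ffunP/(_ (ehead e))|eq_th].
  by rewrite !ffunE eqxx; case: eqP => // _ /eqP; rewrite subr0 oner_eq0.
by apply/ffunP => v; rewrite !ffunE eq_th subrr.
Qed.

Lemma H1_proj_diag_eq1 e :
  H1_proj (edge_chain e) e = 1 <-> etail e = ehead e.
Proof.
rewrite -is_cycle_edge; split=> [p1|e0].
  suff -> : edge_chain e = H1_proj (edge_chain e) by exact: is_cycle_H1_proj.
  apply/eqP; rewrite -subr_eq0; apply/eqP/inner_eq0.
  by rewrite -inner_H1_projK p1 subrr mul0r.
suff -> : H1_proj (edge_chain e) = edge_chain e by rewrite ffunE eqxx.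
apply: int_chain_inj_cycle => //; first exact: is_cycle_H1_proj.
exact: int_chain_H1_proj.
Qed.

End Projection.

(** * Foster coefficients *)

Section Potential.
Variables (R : realType) (G : weighted_graph R) (T : spanning_tree G).
Implicit Types (a : {ffun edge G -> R^o}) (e : edge G).

Definition potential a v : R := inner a (real_chain (tree_path T v)).

(** Orthogonality to the fundamental cycle of [e] says that the integral along
    [e] is the integral along the tree path between the endpoints of [e]. *)
Lemma potentialE a e : (forall c, is_cycle c -> inner a c = 0) ->
  a e * elen e = potential a (ehead e) - potential a (etail e).
Proof.
move=> /(_ _ (is_cycle_real_chain (is_cycle_fund T e))).
rewrite /fund_cycle !real_chainB real_chain_delta innerC !innerBl.
rewrite ![inner _ a]innerC inner_edge => /eqP; rewrite subr_eq0 => /eqP->.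
by [].
Qed.

End Potential.

Section Foster.
Variables (R : realType) (G : weighted_graph R).
Implicit Types (a : {ffun edge G -> R^o}) (e : edge G).

(** A cycle has no net flow through a cut. *)
Lemma cut_balance a (S : pred (vertex G)) : is_cycle a ->
  \sum_e a e *~ ((S (ehead e) : nat)%:Z - (S (etail e) : nat)%:Z) = 0.
Proof.
move=> a0; rewrite (dstar_by_parts a (fun v => (S v : nat)%:Z)) a0.
by rewrite big1 // => v _; rewrite ffunE mul0rz.
Qed.

(** The current pi(e) flows down a potential on every edge but [e].  Cut the
    graph at the level of the lower endpoint of [f]: all edges other than [e]
    flow out of the upper part, so [e] carries back into it at least the flow
    of [f]. *)
Lemma H1_proj_diag_max e f :
  `|H1_proj (edge_chain e) f| <= H1_proj (edge_chain e) e.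
Proof.
have [T] := spanning_tree_exists G.
have [<-|fe] := eqVneq e f; first by rewrite ger0_norm ?H1_proj_diag_ge0.
set p := H1_proj (edge_chain e).
have [p0 pO] := H1_projP (edge_chain e); rewrite -/p in p0 pO.
pose u := potential T (edge_chain e - p).
have uE g : g != e -> - p g * elen g = u (ehead g) - u (etail g).
  by move=> ge; rewrite -potentialE // !ffunE (negPf ge) sub0r.
pose lvl := Num.min (u (ehead f)) (u (etail f)).
pose S v := u v > lvl.
(* [s g] is 1, -1 or 0: the direction in which [g] crosses the cut. *)
pose s g : int := (S (ehead g) : nat)%:Z - (S (etail g) : nat)%:Z.
have s_le1 g (x : R) : x *~ s g <= `|x|.
  rewrite /s; case: (S _); case: (S _) => /=;
  rewrite ?subrr ?mulr0z ?normr_ge0 //.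
    by rewrite subr0 mulr1z ler_norm.
  by rewrite sub0r mulrN1z -normrN ler_norm.
have ps g : g != e -> p g *~ s g <= 0.
  move=> /uE; have lg := len_gt0 g; rewrite /s /S.
  case: (ltP lvl (u (ehead g))) => h; case: (ltP lvl (u (etail g))) => t pg;
    rewrite ?subrr ?mulr0z //.
    rewrite subr0 mulr1z; nra.
  rewrite sub0r mulrN1z; nra.
have psf : p f *~ s f = - `|p f|.
  have := uE f; rewrite eq_sym fe => /(_ isT); have lf := len_gt0 f.
  rewrite /s /S /lvl; case: (ltgtP (u (ehead f)) (u (etail f))) => h pf;
    rewrite ?ltxx ?h /=.
  - rewrite sub0r mulrN1z ger0_norm //; nra.
  - rewrite subr0 mulr1z ler0_norm ?opprK //; nra.
  - rewrite ltxx subrr mulr0z; suff -> : p f = 0 by rewrite normr0 oppr0.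
    move: pf; rewrite h subrr => /eqP.
    by rewrite mulf_eq0 oppr_eq0 (gt_eqF lf) orbF => /eqP.
have := cut_balance S p0; rewrite -/p.
rewrite (bigD1 e) //= (bigD1 f) /=; last by rewrite eq_sym.
rewrite -/(s e) -/(s f) psf => bal.
have rest : \sum_(g | (g != e) && (g != f)) p g *~ s g <= 0.
  by apply: sumr_le0 => g /andP[/ps].
have := s_le1 e (p e); rewrite (ger0_norm (H1_proj_diag_ge0 e)) -/p.
move: bal rest; rewrite -/(s _). lra.
Qed.

Lemma foster_diag e : foster e = H1_proj (edge_chain e) e.
Proof.
apply/le_anti/andP; split.
  apply: bigmax_le => [|f _]; first exact: H1_proj_diag_ge0.
  exact: H1_proj_diag_max.
rewrite -[X in X <= _]ger0_norm ?H1_proj_diag_ge0 //.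
exact: (le_bigmax _ (fun f => `|H1_proj (edge_chain e) f|)).
Qed.

(** The trace of the projection.  The diagonal entry at [e], expanded in
    fundamental cycles, becomes a sum over cotree edges [f]; for each [f],
    summing over [e] first and using self-adjointness gives the coefficient at
    [f] of the projection of the fundamental cycle of [f], which is 1. *)
Lemma sum_foster : \sum_(e : edge G) foster e = (genus G)%:R.
Proof.
have [T] := spanning_tree_exists G.
rewrite (genus_cotree T) -sum1_card natr_sum.
under [LHS]eq_bigr do rewrite foster_diag.
under [LHS]eq_bigr => e _ do
  rewrite (cycle_expand T e (proj1 (H1_projP (edge_chain e)))).
rewrite exchange_big /=; under [RHS]eq_bigl do rewrite in_setC.
apply: eq_bigr => f fT.
apply: (mulIf (lt0r_neq0 (len_gt0 f))); rewrite mulr_suml.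
transitivity (inner (real_chain (fund_cycle T f)) (H1_proj (edge_chain f))).
  apply: eq_bigr => e _; rewrite [real_chain _ e]ffunE -mulrzr.
  by rewrite mulrAC H1_proj_edge_sym mulrAC; congr (_ * _); exact: mulrC.
rewrite innerC; have [p0 pO] := H1_projP (edge_chain f).
have /eqP := pO _ (is_cycle_real_chain (is_cycle_fund T f)).
rewrite innerBl subr_eq0 => /eqP<-; rewrite innerC inner_edge ffunE.
by rewrite fund_cycle_cotree // eqxx.
Qed.

End Foster.

(** * The lattice of integral cycles *)

Section IntegralCycles.
Variables (R : realType) (G : weighted_graph R).
Implicit Types (a b : {ffun edge G -> R^o}).

Definition integral_cycle a : Prop :=
  exists2 z : {ffun edge G -> int}, is_cycle z & a = real_chain z.

Lemma integral_cycleB a b :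
  integral_cycle a -> integral_cycle b -> integral_cycle (a - b).
Proof.
move=> [y y0 ->] [z z0 ->]; exists (y - z); first exact: is_cycleB.
by rewrite real_chainB.
Qed.

Lemma integral_cycle0 : integral_cycle 0.
Proof.
by exists 0; [exact: is_cycle0|apply/ffunP => e; rewrite !ffunE].
Qed.

Lemma integral_cycleN a : integral_cycle a -> integral_cycle (- a).
Proof. by rewrite -sub0r => /(integral_cycleB integral_cycle0). Qed.

Lemma integral_cycleD a b :
  integral_cycle a -> integral_cycle b -> integral_cycle (a + b).
Proof. by move=> a0 /integral_cycleN/(integral_cycleB a0); rewrite opprK. Qed.

Lemma integral_cycle_congr a b :
  integral_cycle (a - b) -> jac_class (int_chain a) = jac_class (int_chain b).
Proof.
by move=> [z z0 abz]; apply/jac_classP; exists z; rewrite // -abz int_chainB.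
Qed.

(** The lattice contains no segment through 0: if [d / n] is integral for all
    [n], then each coefficient of [d] is an integer divisible by every [n]. *)
Lemma lattice_no_line (d : Omega_dual G) :
  (forall s : R, 0 <= s <= 1 ->
     exists2 z : {ffun edge G -> int},
       is_cycle z & s *: d = int_chain (real_chain z)) ->
  d = 0.
Proof.
move=> h; have [|z z0] := h 1; first by rewrite ler01 lexx.
rewrite scale1r => dz; suff z00 : z = 0.
  have -> : d = int_chain 0; last by rewrite int_chain0.
  by rewrite dz z00; congr int_chain; apply/ffunP => e; rewrite !ffunE.
(* Divisibility by an integer larger than the coefficient forces it to be 0. *)
apply/ffunP => e; rewrite ffunE; pose n := `|z e|%N.+1.
have n0 : (n%:R : R) != 0 by rewrite pnatr_eq0.
have [|y y0] := h n%:R^-1.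
  by rewrite invr_ge0 ler0n invf_le1 ?ltr0n // ler1n.
rewrite dz => /(congr1 ( *:%R n%:R)); rewrite scalerA divff // scale1r.
rewrite -int_chainZ => /int_chain_inj_cycle zy.
have /ffunP/(_ e) : real_chain z = n%:R *: real_chain y.
  apply: zy; first exact: is_cycle_real_chain.
  by rewrite /is_cycle linearZ /= is_cycle_real_chain // scaler0.
rewrite !ffunE -[X in _ = X]/(n%:R * (y e)%:~R) pmulrn -intrM => /intr_inj zeE.
apply/eqP; have : (`|z e| < n)%N by [].
rewrite zeE abszM absz_nat; case: (y e =P 0) => [->|/eqP].
  by rewrite mulr0.
by rewrite -absz_gt0 => y_gt0; rewrite ltnNge leq_pmulr.
Qed.

End IntegralCycles.

(** * Subdivisions and integration in them *)

Section Subdivisions.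
Variables (R : realType) (G : tropical_curve R).

Section Breakpoints.
Variables (c : subdivision G) (e : edge G).

Lemma breakpoint_lt i j : (i < j <= (size (cuts c e)).+1)%N ->
  breakpoint c e i < breakpoint c e j.
Proof.
move=> /andP[ij jn].
have s : sorted <%R (0 :: rcons (cuts c e) (elen e)) by exact: cuts_sorted.
apply: (sorted_ltn_nth lt_trans 0 s); rewrite ?inE /= ?size_rcons ?ltnS //.
exact: leq_trans (ltnW ij) jn.
Qed.

Lemma breakpoint_last : breakpoint c e (size (cuts c e)).+1 = elen e.
Proof. by rewrite /breakpoint /= nth_rcons ltnn eqxx. Qed.

Lemma breakpoint_bounds i : (i <= (size (cuts c e)).+1)%N ->
  0 <= breakpoint c e i <= elen e.
Proof.
move=> ile; apply/andP; split.
  by case: i ile => // i ile; apply/ltW/(@breakpoint_lt 0).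
move: ile; rewrite leq_eqVlt => /predU1P[->|ilt].
  by rewrite breakpoint_last.
by rewrite -breakpoint_last; apply/ltW/breakpoint_lt; rewrite ilt leqnn.
Qed.

Lemma vertex_point_break i : (i <= (size (cuts c e)).+1)%N ->
  vertex_point (break_vertex c e i) = seg_point e (breakpoint c e i).
Proof.
case: i => [_|i]; first by rewrite /seg_point insubF ?lexx //= ltxx.
rewrite leq_eqVlt => /predU1P[[->]|]; rewrite /break_vertex.
  rewrite insubF ?ltnn //= breakpoint_last /seg_point insubF ?ltxx ?andbF //.
  by rewrite leNgt len_gt0.
by rewrite ltnS => ilt; rewrite insubT.
Qed.

End Breakpoints.

Lemma seg_point_val (z : {z : edge G * R | 0 < z.2 < elen z.1}) :
  seg_point (val z).1 (val z).2 = inr z.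
Proof. by rewrite /seg_point -surjective_pairing valK. Qed.

Definition point_cut (q : curve_point G) (e : edge G) : seq R :=
  if q is inr z then if (val z).1 == e then [:: (val z).2] else [::] else [::].

Lemma point_cutP q e t : t \in point_cut q e -> 0 < t < elen e.
Proof.
case: q => [//|z] /=; case: eqP => // <-; rewrite mem_seq1 => /eqP->.
exact: valP z.
Qed.

Definition pair_cuts (p q : curve_point G) e : seq R :=
  sort <=%R (undup (point_cut p e ++ point_cut q e)).

Lemma pair_cuts_sorted p q e : path <%R 0 (rcons (pair_cuts p q e) (elen e)).
Proof.
have bnd t : t \in pair_cuts p q e -> 0 < t < elen e.
  by rewrite mem_sort mem_undup mem_cat => /orP[] /point_cutP.
rewrite rcons_path path_min_sorted; last by apply/allP => t /bnd/andP[].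
rewrite lt_sorted_uniq_le sort_uniq undup_uniq sort_le_sorted /=.
have := mem_last 0 (pair_cuts p q e).
rewrite in_cons => /predU1P[->|/bnd/andP[]//].
exact: len_gt0.
Qed.

Lemma cut_is_vertex (c : subdivision G) (q : curve_point G) :
  (forall e, {subset point_cut q e <= cuts c e}) ->
  exists x : vertex (subdivide c), vertex_point x = q.
Proof.
case: q => [v _|z /(_ (val z).1 (val z).2)]; first by exists (inl v).
rewrite /= eqxx mem_seq1 eqxx => /(_ isT) zc.
have ilt : (index (val z).2 (cuts c (val z).1) < size (cuts c (val z).1))%N.
  by rewrite index_mem.
exists (inr (Tagged (fun e => 'I_(size (cuts c e))) (Ordinal ilt))) => /=.
by rewrite /breakpoint /= nth_rcons ilt nth_index // seg_point_val.
Qed.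

Lemma common_model (p q : curve_point G) : exists (c : subdivision G)
  (x y : vertex (subdivide c)), vertex_point x = p /\ vertex_point y = q.
Proof.
pose c := Subdivision (pair_cuts_sorted p q); exists c.
have [|x xp] := @cut_is_vertex c p.
  by move=> e t tp; rewrite mem_sort mem_undup mem_cat tp.
have [|y yq] := @cut_is_vertex c q.
  by move=> e t tq; rewrite mem_sort mem_undup mem_cat tq orbT.
by exists x, y.
Qed.

Variable c : subdivision G.

Lemma int_model_linear k (a b : {ffun edge (subdivide c) -> R^o}) :
  int_model (k *: a + b) = k *: int_model a + int_model b.
Proof.
apply/lfunP => w; rewrite add_lfunE scale_lfunE !int_modelE.
exact: (integrate_linearl k a b (refine_form c (vsval w))).
Qed.

Lemma int_model_edge (f : edge (subdivide c)) :
  int_model (edge_chain f) =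
  int_chain ((elen f / elen (tag f)) *: edge_chain (tag f)).
Proof.
apply/lfunP => w; rewrite int_modelE int_chainZ scale_lfunE int_chainE.
have iE (H : weighted_graph R) (g : edge H) u :
    integrate (edge_chain g) u = u g * elen g.
  by rewrite -inner_edge innerC.
rewrite !iE ffunE -[RHS]/(_ * _) mulrCA divfK //.
exact/lt0r_neq0/len_gt0.
Qed.

Lemma walk_chain_cons (H : weighted_graph R) (s : edge H * bool) P :
  real_chain (walk_chain (s :: P)) =
  (-1) ^+ (~~ s.2) *: edge_chain s.1 + real_chain (walk_chain P).
Proof.
apply/ffunP => f; rewrite !ffunE big_cons eq_sym.
case: eqP => _; rewrite ?mulr0n ?scaler0 ?add0r //.
by rewrite intrD; congr (_ + _); case: s.2; rewrite /= ?scale1r ?scaleN1r.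
Qed.

End Subdivisions.

(** * The Abel-Jacobi map *)

Section AbelJacobi.
Variables (R : realType) (G : tropical_curve R) (T : spanning_tree G).

Definition point_chain (q : curve_point G) : {ffun edge G -> R^o} :=
  match q with
  | inl v => real_chain (tree_path T v)
  | inr z => real_chain (tree_path T (etail (val z).1)) +
               ((val z).2 / elen (val z).1) *: edge_chain (val z).1
  end.

(** The formula that defines [point_chain] inside a segment remains true at its
    endpoints up to an integral cycle.  At the head this cycle is the
    fundamental cycle of the segment. *)
Lemma point_chain_seg e t : 0 <= t <= elen e ->
  integral_cycle (point_chain (seg_point e t) -
    (real_chain (tree_path T (etail e)) + (t / elen e) *: edge_chain e)).
Proof.
move=> /andP[t0 tl]; rewrite /seg_point; case: insubP => /= [z _ zE|].
  by rewrite zE subrr; exact: integral_cycle0.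
rewrite negb_and -!leNgt => tout; case: ifP => [t0'|t_gt0].
  have -> : t = 0 by apply/le_anti; rewrite t0 t0'.
  by rewrite mul0r scale0r addr0 subrr; exact: integral_cycle0.
have -> : t = elen e.
  by apply/le_anti; rewrite tl; move: tout; rewrite t_gt0.
rewrite divff ?scale1r; last exact/lt0r_neq0/len_gt0.
exists (- fund_cycle T e).
  by rewrite -sub0r; apply: is_cycleB; [exact: is_cycle0|exact: is_cycle_fund].
apply/ffunP => f; rewrite !ffunE.
case: eqP => _ /=; rewrite ?intrD ?mulrNz; ring.
Qed.

(** Modulo integral cycles, a walk in any subdivision changes [point_chain] by
    the chain along which it integrates; so the class in the Jacobian is the
    same for all subdivisions and walks. *)
Lemma int_model_walk (c : subdivision G) x y P : walk (subdivide c) x P y ->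
  exists2 b, int_model (real_chain (walk_chain P)) = int_chain b &
    integral_cycle
      (b - (point_chain (vertex_point y) - point_chain (vertex_point x))).
Proof.
elim: P x => [x /= ->|[f s] P IH x /= [<- /IH[b bE bZ]]].
  exists 0; last by rewrite subrr subr0; exact: integral_cycle0.
  apply/lfunP => w; rewrite int_modelE int_chainE /integrate !big1 // => e _;
    by rewrite !ffunE ?big_nil !mul0r.
pose d := (elen f / elen (tag f)) *: edge_chain (tag f).
exists ((-1) ^+ (~~ s) *: d + b).
  rewrite walk_chain_cons int_model_linear bE int_model_edge.
  by rewrite int_chain_is_linear.
have fZ : integral_cycle (d - (point_chain (vertex_point (sub_head f)) -
                          point_chain (vertex_point (sub_tail f)))).
  rewrite /sub_head /sub_tail !vertex_point_break; last 2 first.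
  - exact: ltnW.
  - by [].
  have hZ := point_chain_seg
    (@breakpoint_bounds _ _ c (tag f) (tagged f).+1 (ltn_ord _)).
  have tZ := point_chain_seg
    (@breakpoint_bounds _ _ c (tag f) (tagged f) (ltnW (ltn_ord _))).
  have := integral_cycleB tZ hZ; congr integral_cycle.
  rewrite /d [elen f]/(sub_len f) /sub_len mulrBl scalerBl.
  move: (point_chain _) (point_chain _) (_ *: _) (_ *: _) (real_chain _).
  by move=> h t k l r; apply/ffunP => g; rewrite !ffunE; ring.
rewrite /step_source /step_target /=.
case: s bZ => /= bZ; rewrite ?scale1r ?scaleN1r.
  have := integral_cycleD fZ bZ; congr integral_cycle.
  by rewrite addrACA -opprD [X in _ - X]addrC subrKA.
have := integral_cycleB bZ fZ; congr integral_cycle.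
rewrite -[step_target _ _ _]/(sub_tail f).
move: (d) (point_chain _) (point_chain _) (point_chain _) => l h t z.
by apply/ffunP => g; rewrite !ffunE; ring.
Qed.

Variable p : curve_point G.

Lemma abel_jacobiE q :
  abel_jacobi p q = jac_class (int_chain (point_chain q - point_chain p)).
Proof.
apply: xget_unique => /=.
  have [c [x [y [xp yq]]]] := common_model p q.
  have [P wP] := graph_connected x y; exists c, x, y, P; split=> //.
  have [b -> bZ] := int_model_walk wP.
  by rewrite -xp -yq; apply/esym/integral_cycle_congr.
move=> xi [c [x [y [P [<- <- wP ->]]]]].
by have [b -> bZ] := int_model_walk wP; apply/integral_cycle_congr.
Qed.

Definition tail_lift e : Omega_dual G :=
  int_chain (real_chain (tree_path T (etail e)) - point_chain p).

Lemma affine_lift_segment e :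
  affine_lift p e (tail_lift e) (tail_lift e + int_chain (edge_chain e)).
Proof.
move=> t tb; rewrite abel_jacobiE [_ + int_chain _]addrC addrK.
rewrite [tail_lift e + _]addrC -int_chain_is_linear.
apply: integral_cycle_congr; have := point_chain_seg tb.
by congr integral_cycle;
  apply/ffunP => f; rewrite !ffunE; ring.
Qed.

(** Compare with the lift starting at [tail_lift]: the difference of the two
    affine lifts stays in the lattice, hence so does every fraction of the
    difference of the displacements. *)
Lemma affine_lift_unique e v v' : affine_lift p e v v' ->
  v' - v = int_chain (edge_chain e).
Proof.
move=> lift; set u := tail_lift e; set d := int_chain _.
have len_neq0 : elen e != 0 by exact/lt0r_neq0/len_gt0.
have diff s : 0 <= s <= 1 -> exists2 z : {ffun edge G -> int}, is_cycle z &
    v + s *: (v' - v) - (u + s *: d) = int_chain (real_chain z).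
  move=> /andP[s0 s1]; apply/jac_classP.
  have tb : 0 <= s * elen e <= elen e.
    by rewrite mulr_ge0 ?(ltW (len_gt0 e)) //= ler_piMl // ltW ?len_gt0.
  have := lift _ tb; rewrite (affine_lift_segment tb) mulfK // -/u -/d.
  by rewrite [u + d]addrC addrK => ->.
apply/eqP; rewrite -subr_eq0; apply/eqP/lattice_no_line => s sb.
have [|y y0] := diff 0; first by rewrite lexx ler01.
rewrite !scale0r !addr0 => yE.
have [z z0 zE] := diff s sb; exists (z - y); first exact: is_cycleB.
rewrite real_chainB int_chainB -zE -yE scalerBr [in RHS]opprD addrACA.
by rewrite [v - u + _]addrC addrK.
Qed.

Lemma image_length_foster e : image_length p e = foster e.
Proof.
apply: xget_unique.
  exists (tail_lift e), (tail_lift e + int_chain (edge_chain e)).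
  split; first exact: affine_lift_segment.
  by rewrite addrC addKr dual_norm_int_chain.
by move=> L [v [v' [/affine_lift_unique-> ->]]]; rewrite dual_norm_int_chain.
Qed.

End AbelJacobi.

Theorem theorem5p6 (R : realType) (Gamma : tropical_curve R)
    (p : curve_point Gamma) :
  [/\ forall e : edge Gamma, image_length p e = foster e,
      image_total_length p = (genus Gamma)%:R
    & forall e : edge Gamma,
        image_length p e <= 1 /\ (image_length p e = 1 <-> etail e = ehead e)].
Proof.
have [T] := spanning_tree_exists Gamma.
have lenF e : image_length p e = foster e by exact: image_length_foster T p e.
split=> // [|e].
  by rewrite -sum_foster; apply: eq_bigr => e _.
rewrite lenF foster_diag; split; first exact: H1_proj_diag_le1.
exact: H1_proj_diag_eq1.
Qed.
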